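(* Let $n$ be a fundamental discriminant, let $K=\mathbb{Q}(\sqrt{n})$, and let $T=\{t_1,t_2,\ldots,t_m\}$ be a Diophantine $m$-tuple with the property $D(n)$. Then either $T$ is a norm tuple (i.e. there are integral ideals $\mathfrak{t}_1,\ldots,\mathfrak{t}_m$ of $K$ with $t_i=\mathcal{N}(\mathfrak{t}_i)$ for all $i$), or $T=2T'$, where $T'$ is a norm tuple with the property $D(n/4)$; that is, in the latter case every $t_i$ is divisible by $2$, the set $T'=\{t_1/2,\ldots,t_m/2\}$ satisfies $(t_i/2)(t_j/2)+n/4$ is a square (of a rational number) for all $i\neq j$, and there are integral ideals $\mathfrak{t}_1',\ldots,\mathfrak{t}_m'$ of $K$ with $t_i/2=\mathcal{N}(\mathfrak{t}_i')$ for all $i$.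
   Context: A fundamental discriminant is an integer $n$ which is the discriminant of a quadratic field, i.e. either $n\equiv 1 \pmod 4$ is square-free and $n\neq 1$, or $n=4k$ with $k$ square-free and $k\equiv 2,3\pmod 4$. For an integer $n$, a Diophantine $m$-tuple with the property $D(n)$ is a set $\{a_1,\ldots,a_m\}$ of $m$ distinct positive integers such that $a_ia_j+n$ is a perfect square for all $1\le i<j\le m$. $\mathcal{N}(\cdot)$ denotes the norm from $\mathbb{Q}(\sqrt{n})$ to $\mathbb{Q}$ (for an integral ideal, its absolute norm). A norm tuple is a Diophantine tuple of the form $\{\mathcal{N}(\mathfrak{a}_1),\ldots,\mathcal{N}(\mathfrak{a}_m)\}$ for integral ideals $\mathfrak{a}_i$ of $\mathbb{Q}(\sqrt{n})$.
   Formalization: The formal statement assumes m ≥ 2; for m = 1 property D(n) is vacuous and the claim fails, e.g. n = 5, T = {3}, since 3 is inert in Q(√5) and odd. *)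

(* Defs.v *)
From HB Require Import structures.
From mathcomp Require Import all_boot all_order all_algebra all_field.
From mathcomp Require Import finmap.
From mathcomp Require Import boolp classical_sets cardinality.

Set Implicit Arguments.
Unset Strict Implicit.
Unset Printing Implicit Defensive.

Import Order.TTheory GRing.Theory Num.Theory.
Local Open Scope ring_scope.
Local Open Scope classical_set_scope.

Definition squarefree (k : int) : Prop :=
  forall d : int, (d ^+ 2 %| k)%Z -> `|d| = 1.

(* [(_ %% 4)%Z] is the remainder in {0, 1, 2, 3}, also for negative integers. *)
Definition fundamental_discriminant (n : int) : Prop :=
  [/\ (n %% 4)%Z = 1, squarefree n & n <> 1] \/
  exists k : int,
    [/\ n = 4 * k, squarefree k & (k %% 4)%Z = 2 \/ (k %% 4)%Z = 3].

Definition is_Q_sqrt (n : int) (K : fieldExtType rat) : Prop :=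
  exists2 s : K, s ^+ 2 = n%:~R & <<1; s>>%VS = fullv.

Definition ring_of_integers (K : fieldExtType rat) : set K :=
  [set x | integralOver (intr : int -> K) x].
Arguments ring_of_integers : clear implicits.

Definition integral_ideal (K : fieldExtType rat) (I : set K) : Prop :=
  [/\ I `<=` ring_of_integers K,
      exists2 x, I x & x != 0,
      forall x y, I x -> I y -> I (x + y)
    & forall a x, ring_of_integers K a -> I x -> I (a * x)].

Definition residue_classes (K : fieldExtType rat) (I : set K) : set (set K) :=
  [set [set y | I (y - x)] | x in ring_of_integers K].

(* The absolute norm N(I) = #(O_K / I); [fset_set] is the empty set on infinite
   sets, but O_K / I is finite for every nonzero ideal I. *)
Definition ideal_norm (K : fieldExtType rat) (I : set K) : nat :=
  #|` fset_set (residue_classes I)|%fset.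

(* Property D(q); "square" means square of an element of R, so R = int gives
   perfect squares and R = rat gives squares of rational numbers. *)
Definition diophantine_tuple (R : comNzRingType) (q : R) (m : nat)
    (t : 'I_m -> nat) : Prop :=
  [/\ forall i, (0 < t i)%N,
      injective t
    & forall i j : 'I_m, (i < j)%N -> exists x : R, (t i * t j)%:R + q = x ^+ 2].

Definition norm_tuple (K : fieldExtType rat) (R : comNzRingType) (q : R)
    (m : nat) (t : 'I_m -> nat) : Prop :=
  diophantine_tuple q t /\
  exists I : 'I_m -> set K,
    forall i, integral_ideal (I i) /\ t i = ideal_norm (I i).

(* Main.v *)
(** Put w = (n + sqrt n) / 2, so that O_K = Z[w] and c + w has norm
    f(c) = c^2 + c n + (n^2 - n) / 4.  If t divides f(c), the lattice
    g (Z t + Z (c + w)) is an ideal of norm g^2 t.  Since 4 f(c) = (2 c + n)^2 - n,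
    f has a root modulo u for every odd u dividing some x^2 - n, and also a root
    modulo 2 u unless n = 5 mod 8.  Every t_i divides some x^2 - n and has the form
    g^2 u or 2 g^2 u with u odd, so it is a norm unless n = 5 mod 8 and its 2-adic
    valuation is odd.  In that case t_i t_j = x^2 - n is 4 modulo 8 for all j <> i,
    which forces every t_j to be twice an odd number. *)

Require Import Defs.
From mathcomp Require Import all_boot all_order all_algebra all_field.
From mathcomp Require Import boolp classical_sets cardinality.
From mathcomp Require Import zify ring lra.

Set Implicit Arguments.
Unset Strict Implicit.
Unset Printing Implicit Defensive.

Import Order.TTheory GRing.Theory Num.Theory.
Local Open Scope ring_scope.

(** * Square-free integers and fundamental discriminants *)

(** The square of the denominator of [q] is coprime to that of its numerator, hence divides [k], so
    the denominator is 1. *)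
Lemma rat_sqr_sqfree_int (k N : int) (q : rat) :
  squarefree k -> k%:~R * q ^+ 2 = N%:~R -> exists z : int, q = z%:~R.
Proof.
move=> sqf_k kq2N.
have kn2 : k * numq q ^+ 2 = N * denq q ^+ 2.
  apply: (@intr_inj rat); rewrite !expr2 !intrM -kq2N expr2.
  by rewrite numqE; ring.
have cop : coprimez (denq q ^+ 2) (numq q ^+ 2).
  by rewrite coprimezXl // coprimezXr // coprimez_sym; exact: coprime_num_den.
have /sqf_k d1 : (denq q ^+ 2 %| k)%Z.
  by rewrite -(Gauss_dvdzl _ cop) kn2 dvdz_mull.
exists (numq q); rewrite numqE.
have -> : denq q = 1 by have := denq_gt0 q; lia.
by rewrite mulr1.
Qed.

Lemma sqfree1 : squarefree 1.
Proof. by move=> d; rewrite dvdz1 abszX -mulnn muln_eq1 andbb; lia. Qed.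

Lemma fundamental_discriminant_non_square (n : int) (q : rat) :
  fundamental_discriminant n -> n%:~R <> q ^+ 2.
Proof.
move=> hn nq2; have [z qz] : exists z : int, q = z%:~R.
  by apply: (@rat_sqr_sqfree_int 1 n); [exact: sqfree1 | rewrite mul1r].
have nz2 : n = z ^+ 2 by apply: (@intr_inj rat); rewrite nq2 qz rmorphXn.
case: hn => [[_ sqf_n n1]|[k [nk _ k4]]].
  apply: n1; have := sqf_n z; rewrite -nz2 dvdzz => /(_ isT) z1.
  by rewrite nz2 expr2; nia.
rewrite expr2 in nz2.
(* Squares are 0, 1, 4 or 9 modulo 16, whereas [4 * k] is 8 or 12. *)
have zE := divz_eq z 4; move: zE nz2.
have : 0 <= (z %% 4)%Z < 4 by lia.
set a := (z %/ 4)%Z; set b := (z %% 4)%Z => b_lt ->.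
have : b = 0 \/ b = 1 \/ b = 2 \/ b = 3 by lia.
by case=> [|[|[|]]] ->; rewrite nk; lia.
Qed.

(** * Roots of the norm form modulo [u] and modulo [2 * u] *)

Lemma norm_form_root_odd (n e x : int) (u : nat) :
  4 * e = n ^+ 2 - n -> odd u -> (u%:Z %| x ^+ 2 - n)%Z ->
  exists c : int, (u%:Z %| c ^+ 2 + c * n + e)%Z.
Proof.
move=> en odd_u /dvdzP [q xq].
have uE : u%:Z = 2 * (u./2)%:Z + 1 by lia.
(* [u./2.+1] inverts 2 modulo [u], so this [c] satisfies 2c + n = x + u(x - n). It suffices to show
   that [u] divides 4 f(c) = (2c + n)^2 - n. *)
exists ((x - n) * (u./2.+1)%:Z).
have cop : coprimez u%:Z (2 ^+ 2).
  by rewrite coprimezXr // coprimezE /= coprimen2.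
rewrite -(Gauss_dvdzr _ cop) (_ : 2 ^+ 2 = 4) //; apply/dvdzP.
set h := u./2.+1%:Z; have hE : 2 * h = u%:Z + 1 by rewrite /h; lia.
exists (q + 2 * x * (x - n) + u%:Z * (x - n) ^+ 2).
transitivity (((x - n) * (2 * h)  + n) ^+ 2 - n).
  by rewrite !mulrDr en; ring.
rewrite hE.
have -> : n = x ^+ 2 - q * u%:Z by rewrite -xq; ring.
by ring.
Qed.

Lemma mul_succ_even (c : int) : exists b : int, c * (c + 1) = 2 * b.
Proof.
have [h [->|->]] : exists h, c = 2 * h \/ c = 2 * h + 1.
- by exists (c %/ 2)%Z; lia.
- by exists (h * (2 * h + 1)); ring.
by exists ((2 * h + 1) * (h + 1)); ring.
Qed.

(** Replacing [c] by c + u keeps the root modulo [u] and changes f(c) by u(2c + u + n). For even [n]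
    this is odd, so one of the two values is even. For odd [n], the hypotheses force n = 1 modulo 8;
    then [e] is even and f(c) = c(c + 1) = 0 modulo 2 for every [c]. *)
Lemma norm_form_root_double (n e x : int) (u : nat) :
  4 * e = n ^+ 2 - n -> odd u -> (u%:Z %| x ^+ 2 - n)%Z -> (n %% 8)%Z != 5 ->
  exists c : int, ((2 * u)%N%:Z %| c ^+ 2 + c * n + e)%Z.
Proof.
move=> en odd_u ux n8; have [c uc] := norm_form_root_odd en odd_u ux.
have cop : coprimez 2 u%:Z by rewrite coprimezE /= coprime2n.
have u2 : exists v, u%:Z = 2 * v + 1 by exists (u./2)%:Z; lia.
suff [d ud d2] : exists2 d : int, (u%:Z %| d ^+ 2 + d * n + e)%Z
    & (2 %| d ^+ 2 + d * n + e)%Z.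
  by exists d; rewrite PoszM Gauss_dvdz // d2 ud.
have [even_c|odd_c] := boolP (2 %| c ^+ 2 + c * n + e)%Z; first by exists c.
exists (c + u%:Z).
  have -> : (c + u%:Z) ^+ 2 + (c + u%:Z) * n + e =
    c ^+ 2 + c * n + e + u%:Z * (2 * c + u%:Z + n) by ring.
  by rewrite rpredD // dvdz_mulr.
have -> : (c + u%:Z) ^+ 2 + (c + u%:Z) * n + e =
    c ^+ 2 + c * n + e + u%:Z * (2 * c + u%:Z + n) by ring.
have [n2|n2] : (2 %| n)%Z \/ ~~ (2 %| n)%Z by case: (2 %| n)%Z; [left|right].
  move: odd_c; set A := c ^+ 2 + _ + _; clearbody A; case: u2 => v ->.
  move/dvdzP: n2 => [w ->]; lia.
exfalso; move/negP: odd_c; apply.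
have n8E : n = 8 * (n %/ 8)%Z + (n %% 8)%Z by rewrite [LHS](divz_eq n 8) mulrC.
have r8 : 0 <= (n %% 8)%Z < 8 by lia.
have [v nv] : exists v, n = 2 * v + 1 by exists (n %/ 2)%Z; lia.
move: n8E r8 n8 en; set a := (n %/ 8)%Z; set r := (n %% 8)%Z => n8E r8 n8 en.
have r1 : r = 1.
  have : r = 1 \/ r = 3 \/ r = 7 by lia.
  by case=> [//|[]] rE; move: en; rewrite n8E rE expr2; lia.
have eE : e = 2 * (8 * a * a + a) by move: en; rewrite n8E r1 expr2; lia.
have [b cb] := mul_succ_even c.
apply/dvdzP; exists (b + c * v + 8 * a * a + a); rewrite eE nv.
have -> : c ^+ 2 + c * (2 * v + 1) = c * (c + 1) + 2 * c * v by ring.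
by rewrite cb; ring.
Qed.

(** * Lattice ideals and their norms *)

(* [w] plays the role of (n + sqrt n) / 2, whose norm is [e = (n ^+ 2 - n) / 4]. *)
Definition is_integral_generator (K : fieldExtType rat) (n e : int) (w : K) :=
  [/\ w ^+ 2 = n%:~R * w - e%:~R,
      forall x, ring_of_integers K x <-> exists a b : int, x = a%:~R + b%:~R * w
    & forall a b : int, a%:~R + b%:~R * w = 0 -> a = 0 /\ b = 0].

(* [g (Z t + Z (c + w))] *)
Definition quadratic_lattice (K : fieldExtType rat) (w : K) (g t c : int) : set K :=
  [set x | exists p q : int, x = (g * (t * p + c * q))%:~R + (g * q)%:~R * w]%classic.

(** Stability under [w] follows from w t = t (c + w) - c t and w (c + w) = (c + n)(c + w) - f(c),
    where f(c) is a multiple of [t]. *)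
Lemma quadratic_lattice_ideal (K : fieldExtType rat) (n e : int) (w : K)
    (g t c : int) :
  is_integral_generator n e w -> 0 < g -> 0 < t ->
  (t %| c ^+ 2 + c * n + e)%Z ->
  integral_ideal (quadratic_lattice w g t c).
Proof.
move=> [w2 OK_w indep] g_gt0 t_gt0 /dvdzP [f cf]; split.
- by move=> x [p [q ->]]; apply/OK_w; exists (g * (t * p + c * q)), (g * q).
- exists (g * t)%:~R; first by exists 1, 0; rewrite !mulr0 mul0r !addr0 mulr1.
  apply/eqP => gt0.
  have [] := indep (g * t) 0; first by rewrite gt0 mul0r addr0.
  by nia.
- move=> _ _ [p1 [q1 ->]] [p2 [q2 ->]]; exists (p1 + p2), (q1 + q2).
  by rewrite !(intrM, intrD); ring.
- move=> _ _ /OK_w [a [b ->]] [p [q ->]].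
  exists (a * p - b * c * p - b * f * q), (a * q + b * t * p + b * c * q + b * n * q).
  have -> : (a%:~R + b%:~R * w) * ((g * (t * p + c * q))%:~R + (g * q)%:~R * w) =
    (a * g * (t * p + c * q))%:~R + (a * g * q + b * g * (t * p + c * q))%:~R * w
      + (b * g * q)%:~R * w ^+ 2 by rewrite !(intrM, intrD); ring.
  rewrite w2.
  have -> : e = f * t - c ^+ 2 - c * n by rewrite -cf; ring.
  by rewrite !(intrM, intrD, mulrNz); ring.
Qed.

(** The elements i + j w with 0 <= i < g t and 0 <= j < g represent each class exactly once; [rep]
    lists them through k = i g + j. *)
Lemma quadratic_lattice_norm (K : fieldExtType rat) (n e : int) (w : K)
    (g t : nat) (c : int) :
  is_integral_generator n e w -> (0 < g)%N -> (0 < t)%N ->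
  ideal_norm (quadratic_lattice w g%:Z t%:Z c) = (g ^ 2 * t)%N.
Proof.
move=> [w2 OK_w indep] g_gt0 t_gt0; set I := quadratic_lattice _ _ _ _.
pose rep (k : nat) : K := ((k %/ g)%N%:Z)%:~R + ((k %% g)%N%:Z)%:~R * w.
pose class (x : K) : set K := [set y | I (y - x)]%classic.
have IB x y : I x -> I y -> I (x - y).
  move=> [p1 [q1 ->]] [p2 [q2 ->]]; exists (p1 - p2), (q1 - q2).
  by rewrite !(intrM, intrD, mulrNz); ring.
have I0 : I 0 by exists 0, 0; rewrite !mulr0 mul0r !addr0.
have classE x y : I (x - y) -> class x = class y.
  move=> Ixy; apply/seteqP; split=> z; rewrite /class /= => Iz.
    by have -> : z - y = (z - x) - (0 - (x - y)); [ring|exact: IB (IB _ _ I0 Ixy)].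
  by have -> : z - x = (z - y) - (x - y); [ring|exact: IB].
apply: card_fset_set.
have -> : residue_classes I = [set class (rep k) | k in `I_(g ^ 2 * t)%N]%classic.
  apply/seteqP; split=> [_ [x /OK_w [a [b ->]] <-]|_ [k _ <-]].
    pose j := (b %% g%:Z)%Z; pose q := (b %/ g%:Z)%Z.
    (* Subtracting q g (c + w) brings the coefficient of [w] down to [j] and leaves [a'] as the
       rational part, which is then reduced modulo g t. *)
    pose a' := a - g%:Z * c * q.
    pose i := (a' %% (g * t)%N%:Z)%Z; pose p := (a' %/ (g * t)%N%:Z)%Z.
    have bE : b = q * g%:Z + j by exact: divz_eq.
    have aE : a' = p * (g * t)%N%:Z + i by exact: divz_eq.
    have j_ge0 : 0 <= j by apply: modz_ge0; lia.
    have j_lt : j < g%:Z by apply: ltz_pmod; lia.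
    have i_ge0 : 0 <= i by apply: modz_ge0; nia.
    have i_lt : i < (g * t)%N%:Z by apply: ltz_pmod; nia.
    have jE : j = `|j|%N by lia.
    have iE : i = `|i|%N by lia.
    exists (`|i| * g + `|j|)%N.
      by rewrite /=; nia.
    apply/esym/classE.
    have jg : (`|j| < g)%N by lia.
    rewrite /rep divnMDl // divn_small // addn0 modnMDl modn_small //.
    exists p, q; rewrite -iE -jE.
    have -> : a = p * (g%:Z * t%:Z) + i + g%:Z * c * q by rewrite -PoszM -aE /a'; ring.
    by rewrite {1}bE !(intrM, intrD); ring.
  by exists (rep k) => //; apply/OK_w; exists (k %/ g)%N%:Z, (k %% g)%N%:Z.
apply: inj_card_eq => k l; rewrite !inE /= => k_lt l_lt kl.
have : class (rep l) (rep k) by rewrite -kl /class /= subrr.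
move=> [p [q]] /eqP; rewrite -subr_eq0 => /eqP klpq.
have [] := indep ((k %/ g)%N%:Z - (l %/ g)%N%:Z - g%:Z * (t%:Z * p + c * q))
                 ((k %% g)%N%:Z - (l %% g)%N%:Z - g%:Z * q).
  rewrite -[RHS]klpq /rep !(intrM, intrD, mulrNz); ring.
have kg := ltn_pmod k g_gt0; have lg := ltn_pmod l g_gt0.
(* The [w] coordinates lie in [0, g) and differ by g q, so [q] vanishes; the rational parts lie in
   [0, g t) and then differ by g t p. *)
move=> E1 E2; have q0 : q = 0 by nia.
have kt : (k %/ g < g * t)%N by rewrite ltn_divLR //; lia.
have lt : (l %/ g < g * t)%N by rewrite ltn_divLR //; lia.
have p0 : p = 0 by move: E1; rewrite q0 mulr0 addr0; nia.
rewrite (divn_eq k g) (divn_eq l g).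
by congr (_ * _ + _)%N; [move: E1|move: E2]; rewrite q0 ?p0 !mulr0 ?mulr0; lia.
Qed.

(** * The ring of integers of the quadratic field *)

(** Gauss's lemma: [q] is proportional to an integral factor [q1] of [p]. As [p] is monic, the
    leading coefficient of [q1] is a unit, with inverse that of the cofactor [r]. *)
Lemma monic_rat_factor_int (p : {poly int}) (q : {poly rat}) :
  p \is monic -> q \is monic -> q %| map_poly intr p ->
  forall i, exists z : int, q`_i = z%:~R.
Proof.
move=> mon_p mon_q /dvdpP_rat_int [q1 [a a0 qE] [r pE]] i.
have lead1 : lead_coef q1 * lead_coef r = 1.
  by rewrite -lead_coefM -pE; exact/eqP.
have aq1 : a * (lead_coef q1)%:~R = 1.
  move: mon_q; rewrite qE monicE lead_coefZ lead_coef_map_inj ?rmorph0 //.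
    by move/eqP.
  exact: intr_inj.
exists (lead_coef r * q1`_i).
have -> : q`_i = a * (q1`_i)%:~R by rewrite qE coefZ coef_map.
rewrite intrM; congr (_ * _).
have lr : (lead_coef q1)%:~R * (lead_coef r)%:~R = 1 :> rat by rewrite -intrM lead1.
by rewrite -[LHS]mulr1 -[in LHS]lr mulrA aq1 mul1r.
Qed.

Lemma quadratic_span (K : fieldExtType rat) (n : int) (s : K) :
  s ^+ 2 = n%:~R -> <<1; s>>%VS = fullv ->
  forall x : K, exists r q : rat, x = r%:A + q *: s.
Proof.
move=> s2 gen x.
have : x \in <<1; s>>%VS by rewrite gen memvf.
case/Fadjoin_polyP=> p p1 ->; rewrite horner_coef.
elim/big_ind: _ => [|_ _ [r1 [q1 ->]] [r2 [q2 ->]]|i _].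
- by exists 0, 0; rewrite !scale0r addr0.
- by exists (r1 + r2), (q1 + q2); rewrite !scalerDl addrACA.
have [r [q ->]] : exists r q : rat, s ^+ i = r%:A + q *: s.
  elim: (nat_of_ord i) => [|j [r [q IH]]].
    by exists 1, 0; rewrite scale1r scale0r addr0.
  exists (q * n%:~R), r.
  rewrite exprS IH mulrDr -scalerAr mulr1 -scalerAr -expr2 s2 addrC.
  by rewrite -(rmorph_int (in_alg K)) /= scalerA.
have /vlineP [a ->] : p`_i \in 1%VS by exact: (polyOverP p1).
by exists (a * r), (a * q); rewrite -scalerAl mul1r scalerDr !scalerA.
Qed.

Lemma quadratic_independent (K : fieldExtType rat) (n : int) (s : K) (r q : rat) :
  fundamental_discriminant n -> s ^+ 2 = n%:~R ->
  r%:A + q *: s = 0 -> r = 0 /\ q = 0.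
Proof.
move=> hn s2 rqs.
have q0 : q = 0.
  apply/eqP/negPn/negP => q0.
  apply: (@fundamental_discriminant_non_square n (- r / q) hn).
  apply: (fmorph_inj (in_alg K)); rewrite rmorph_int -s2 rmorphXn /=.
  congr (_ ^+ 2); apply: (scalerI q0); rewrite scalerA mulrC divfK //.
  by rewrite scaleNr; apply/eqP; rewrite -addr_eq0 addrC rqs.
split=> //; move: rqs; rewrite q0 scale0r addr0 => /eqP.
by rewrite scaler_eq0 oner_eq0 orbF => /eqP.
Qed.

(** The minimal polynomial of the element divides its integral equation over the rationals, so
    Gauss's lemma makes its coefficients integers. *)
Lemma quadratic_integral_trace_norm (K : fieldExtType rat) (n : int) (s : K) (r q : rat) :
  fundamental_discriminant n -> s ^+ 2 = n%:~R ->
  ring_of_integers K (r%:A + q *: s) ->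
  exists A N : int, 2 * r = A%:~R /\ r ^+ 2 - n%:~R * q ^+ 2 = N%:~R.
Proof.
move=> hn s2 [p mon_p /rootP px0]; set x := r%:A + q *: s in px0.
have pE : map_poly intr p = map_poly (in_alg K) (map_poly (intr : int -> rat) p).
  by rewrite -map_poly_comp; apply: eq_map_poly => z /=; rewrite -(rmorph_int (in_alg K)).
have eval_rem (d : {poly rat}) : (map_poly (in_alg K) d).[x] = 0 ->
    (map_poly (in_alg K) (map_poly intr p %% d)).[x] = 0.
  move=> dx0; move: px0; rewrite pE {1}(divp_eq (map_poly intr p) d).
  by rewrite rmorphD rmorphM /= hornerD hornerM dx0 mulr0 add0r.
have [q0|q0] := eqVneq q 0.
  have xr : x = r%:A by rewrite /x q0 scale0r addr0.
  have dvd : 'X - r%:P %| map_poly intr p.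
    rewrite dvdp_XsubCl; apply/rootP; apply: (fmorph_inj (in_alg K)).
    by rewrite -horner_map -pE /= -xr px0 scale0r.
  have [z] := monic_rat_factor_int mon_p (monicXsubC r) dvd 0.
  rewrite !coefE /= sub0r => rz; exists (- 2 * z), (z ^+ 2).
  by rewrite q0 !(intrM, expr2) -rz; split; ring.
pose d : {poly rat} := ('X - r%:P) ^+ 2 - (n%:~R * q ^+ 2)%:P.
have size_d : size d = 3%N.
  by rewrite size_polyDl size_exp_XsubC // size_polyN (leq_ltn_trans (size_polyC_leq1 _)).
have mon_d : d \is monic.
  rewrite monicE lead_coefDl ?lead_coef_exp ?lead_coefXsubC ?expr1n //.
  by rewrite size_exp_XsubC size_polyN (leq_ltn_trans (size_polyC_leq1 _)).
have dx0 : (map_poly (in_alg K) d).[x] = 0.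
  rewrite rmorphB rmorphXn rmorphB /= map_polyX !map_polyC /= !hornerE.
  rewrite /x addrAC subrr add0r exprZn s2 -(rmorph_int (in_alg K)) /= scalerA.
  by apply/eqP; rewrite subr_eq0; apply/eqP; congr (_%:A); ring.
have dvd : d %| map_poly intr p.
  (* The remainder has degree at most 1 and vanishes at [x]; since 1 and [s] are independent and [q]
     is nonzero, it is zero. *)
  have := eval_rem _ dx0; set e := _ %% _ => ex0.
  have size_e : (size e <= 2)%N by rewrite -ltnS -size_d ltn_modp -size_poly_eq0 size_d.
  have eE : e = e`_1 *: 'X + (e`_0)%:P.
    apply/polyP => -[|[|i]]; rewrite !coefE /= ?mulr0 ?mulr1 ?addr0 ?add0r //.
    by rewrite nth_default // (leq_trans size_e).
  move: ex0; rewrite eE rmorphD /= map_polyZ map_polyX map_polyC /= !hornerE.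
  have -> : (e`_1)%:A * x + (e`_0)%:A = (e`_1 * r + e`_0)%:A + (e`_1 * q) *: s.
    by rewrite /x -scalerAl mul1r scalerDr !scalerA scalerDl addrAC.
  case/(quadratic_independent hn s2) => e0 /eqP.
  rewrite mulf_eq0 (negPf q0) orbF => /eqP e1.
  move: e0; rewrite e1 mul0r add0r => e0.
  by rewrite /dvdp -/e eE e1 e0 scale0r add0r.
have dE : d = 'X^2 - (2 * r) *: 'X + (r ^+ 2 - n%:~R * q ^+ 2)%:P.
  by rewrite /d -mul_polyC !(rmorphM, rmorphB, rmorphXn) /= rmorphMn /=; ring.
have [A AE] := monic_rat_factor_int mon_p mon_d dvd 1.
have [N NE] := monic_rat_factor_int mon_p mon_d dvd 0.
exists (- A), N; move: AE NE; rewrite dE !coefE /= mulrNz => <- <-.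
by split; ring.
Qed.

Lemma int_parity (z : int) : exists y : int, z = 2 * y \/ z = 2 * y + 1.
Proof. by exists (z %/ 2)%Z; lia. Qed.

(** Modulo 4 the equation reads A^2 = b^2, so [A], [b] and n b have the same parity. The conclusion
    rewrites (A + b s) / 2 as c + b w. *)
Lemma quarter_form_parity_odd (n A b N : int) :
  (n %% 4)%Z = 1 -> A ^+ 2 - n * b ^+ 2 = 4 * N -> exists c, A = 2 * c + n * b.
Proof.
move=> n1; have := divz_eq n 4; rewrite n1; move: (n %/ 4)%Z => m ->; clear n n1.
have [x xE] := int_parity A; have [y yE] := int_parity b.
case: xE => ->; case: yE => -> E.
- by exists (x - (m * 4 + 1) * y); ring.
- by exfalso; lia.
- by exfalso; lia.
by exists (x - (m * 4 + 1) * y - m * 2); ring.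
Qed.

(** Squares are 0 or 1 modulo 4, so if [A] or [b] is odd then A^2 - k b^2 is nonzero modulo 4. *)
Lemma quarter_form_parity_even (k A b N : int) :
  (k %% 4)%Z = 2 \/ (k %% 4)%Z = 3 -> A ^+ 2 - k * b ^+ 2 = 4 * N ->
  exists x y : int, A = 2 * x /\ b = 2 * y.
Proof.
move=> k23; have := divz_eq k 4; move: k23; move: (k %/ 4)%Z (k %% 4)%Z => m r k23 ->.
clear k.
have [x xE] := int_parity A; have [y yE] := int_parity b.
case: xE => ->; case: yE => -> E; first by exists x, y.
all: by exfalso; case: k23 => rE; rewrite rE in E; lia.
Qed.

Lemma integral_generator_exists (K : fieldExtType rat) (n : int) :
  fundamental_discriminant n -> is_Q_sqrt n K ->
  exists (e : int) (w : K), 4 * e = n ^+ 2 - n /\ is_integral_generator n e w.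
Proof.
move=> hn [s s2 gen].
have [e eE] : exists e, 4 * e = n ^+ 2 - n.
  case: hn => [[n1 _ _]|[k [-> _ _]]]; last by exists (4 * k ^+ 2 - k); ring.
  have nE := divz_eq n 4; rewrite n1 in nE.
  by exists (4 * (n %/ 4)%Z ^+ 2 + (n %/ 4)%Z); rewrite [in RHS]nE; ring.
pose w : K := 2^-1 *: (n%:~R + s).
have sE : s = 2 * w - n%:~R.
  by rewrite /w mulr_natl -scaler_nat scalerA divff // scale1r addrC addKr.
have w2 : w ^+ 2 = n%:~R * w - e%:~R.
  have k4 : (4 : K) != 0 by rewrite -(rmorph_nat (in_alg K)) fmorph_eq0.
  have e4 : 4 * e%:~R = n%:~R ^+ 2 - n%:~R :> K.
    by rewrite -[4]/(4%:~R) -intrM eE !(intrD, mulrNz, intrM).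
  apply: (mulfI k4); rewrite mulrBr e4.
  transitivity (s ^+ 2 + 4 * (n%:~R * w) - n%:~R ^+ 2); first by rewrite sE; ring.
  by rewrite s2; ring.
have ab_coord (a b : int) : a%:~R + b%:~R * w
    = (a%:~R + b%:~R * n%:~R / 2)%:A + (b%:~R / 2) *: s.
  rewrite /w -!(rmorph_int (in_alg K)) /= -scalerAl mul1r scalerA scalerDr.
  by rewrite scalerA addrA -scalerDl mulrAC.
exists e, w; split=> //; split=> //.
- move=> x; split.
    have [r [q ->]] := quadratic_span s2 gen x.
    move=> /(quadratic_integral_trace_norm hn s2) [A [N [rA rqN]]].
    suff [b [c [qb Ac]]] : exists b c : int, 2 * q = b%:~R /\ A = 2 * c + n * b.
      exists c, b; rewrite ab_coord; congr (_%:A + _ *: _); last by lra.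
      by move: rA; rewrite Ac intrD !intrM; lra.
    have nq2 : n%:~R * (2 * q) ^+ 2 = (A ^+ 2 - 4 * N)%:~R.
      by rewrite intrD mulrNz !(expr2, intrM) -rA -rqN; ring.
    case: hn => [[n1 sqf_n _]|[k [nk sqf_k k23]]].
      have [b qb] := rat_sqr_sqfree_int sqf_n nq2.
      have [|c Ac] := @quarter_form_parity_odd n A b N n1; last by exists b, c.
      suff -> : n * b ^+ 2 = A ^+ 2 - 4 * N by ring.
      by apply: (@intr_inj rat); rewrite -nq2 qb !(expr2, intrM).
    (* Only [k] is square-free here, which gives the integrality of 4 q; parity then shows that 4 q
       is even. *)
    have kq2 : k%:~R * (4 * q) ^+ 2 = (A ^+ 2 - 4 * N)%:~R.
      by rewrite -nq2 nk intrM; ring.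
    have [b qb] := rat_sqr_sqfree_int sqf_k kq2.
    have [|x1 [y [Ax by2]]] := @quarter_form_parity_even k A b N k23.
      suff -> : k * b ^+ 2 = A ^+ 2 - 4 * N by ring.
      by apply: (@intr_inj rat); rewrite -kq2 qb !(expr2, intrM).
    exists y, (x1 - 2 * k * y); split; last by rewrite Ax nk; ring.
    by move: qb; rewrite by2 intrM; lra.
  move=> [a [b ->]].
  have int_z (z : int) : integralOver (intr : int -> K) z%:~R by exact: integral_id.
  have int_w : integralOver (intr : int -> K) w.
    exists ('X * ('X - n%:P) + e%:P).
      rewrite monicE lead_coefDl; first by rewrite lead_coefM lead_coefX lead_coefXsubC.
      rewrite mulrC size_mulX ?polyXsubC_eq0 // size_XsubC.
      exact: leq_ltn_trans (size_polyC_leq1 _) _.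
    apply/rootP; rewrite rmorphD rmorphM rmorphB /= map_polyX !map_polyC /= !hornerE.
    by rewrite mulrBr -expr2 w2; ring.
  pose RtoK : {rmorphism int -> K} := intr.
  apply: (@integral_add _ _ RtoK) (int_z a) _.
  exact: (@integral_mul _ _ RtoK) (int_z b) int_w.
- move=> a b; rewrite ab_coord => /(quadratic_independent hn s2) [ab0 b0].
  have bz : b%:~R = 0 :> rat by lra.
  move: ab0; rewrite bz !mul0r addr0 => /eqP; rewrite intr_eq0 => /eqP ->.
  by split=> //; apply/eqP; rewrite -(intr_eq0 rat) bz.
Qed.

(** * Ideals of prescribed norm *)

Lemma ideal_of_norm (K : fieldExtType rat) (n x : int) (g u : nat) (b : bool) :
  fundamental_discriminant n -> is_Q_sqrt n K -> (b -> (n %% 8)%Z != 5) ->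
  (0 < g)%N -> odd u -> (u%:Z %| x ^+ 2 - n)%Z ->
  exists I : set K, integral_ideal I /\ (g ^ 2 * (2 ^ b * u))%N = ideal_norm I.
Proof.
move=> hn hK n8 g0 odd_u ux; have [e [w [en wP]]] := integral_generator_exists hn hK.
have [c uc] : exists c : int, ((2 ^ b * u)%N%:Z %| c ^+ 2 + c * n + e)%Z.
  case: b n8 => [/(_ isT)|_]; first exact: norm_form_root_double en odd_u ux.
  by rewrite mul1n; exact: norm_form_root_odd en odd_u ux.
have u0 : (0 < 2 ^ b * u)%N by rewrite muln_gt0 expn_gt0 /=; exact: odd_gt0.
exists (quadratic_lattice w g%:Z (2 ^ b * u)%N%:Z c); split.
  by apply: quadratic_lattice_ideal wP _ _ uc; rewrite ltz_nat.
by rewrite (quadratic_lattice_norm _ wP).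
Qed.

(** * The 2-adic valuations in the tuple *)

Lemma square_mul_odd_decomposition (t : nat) : (0 < t)%N ->
  exists g u : nat,
    [/\ (0 < g)%N, odd u & t = (g ^ 2 * (2 ^ odd (logn 2 t) * u))%N].
Proof.
move=> t0; have [u cop tE] := pfactor_coprime (isT : prime 2) t0.
exists (2 ^ (logn 2 t)./2)%N, u; split; rewrite ?expn_gt0 //; first by rewrite -coprime2n.
rewrite {1}tE -{1}(odd_double_half (logn 2 t)) expnD -expnM muln2.
by rewrite mulnC -mulnA mulnCA.
Qed.

(** Since a b is even and [n] is odd, [x] is odd; hence x^2 = 1 and a b = 1 - 5 = 4 modulo 8. *)
Lemma square_sub_five_mod_eight_product (n x : int) (a b : nat) :
  (n %% 8)%Z = 5 -> (a * b)%:R + n = x ^+ 2 -> ~~ odd a -> (8 %| a * b + 4)%N.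
Proof.
move=> n5 abx /negbTE even_a; have := divz_eq n 8; rewrite n5 => nE.
have [y [xE|xE]] := int_parity x; rewrite xE expr2 in abx; first by lia.
have [h hE] := mul_succ_even y.
have : (a * b)%:R = 8 * h + 1 - n by rewrite -[LHS](addrK n) abx; lia.
by lia.
Qed.

(** The valuation of a b at 2 is exactly 2 and that of [a] is odd, so both factors have valuation
    1. *)
Lemma four_mod_eight_product (a b : nat) :
  (8 %| a * b + 4)%N -> odd (logn 2 a) ->
  (exists2 u, odd u & a = (2 * u)%N) /\ (exists2 u, odd u & b = (2 * u)%N).
Proof.
move=> /dvdnP [k abk] odd_a.
have a0 : (0 < a)%N by case: a odd_a {abk}.
have [g [u [_ odd_u]]] := square_mul_odd_decomposition a0.
rewrite odd_a expn1 => aE.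
(* An even [g] would make a = 2 g^2 u divisible by 8. *)
have odd_g : odd g.
  apply/negPn/negP => even_g.
  have gE : g = (2 * g./2)%N by lia.
  move: abk; rewrite aE gE -mulnn; lia.
have odd_v : odd (g ^ 2 * u) by rewrite oddM oddX odd_g.
have avE : a = (2 * (g ^ 2 * u))%N by rewrite aE; lia.
split; first by exists (g ^ 2 * u)%N.
move: abk odd_v; rewrite avE; move: (g ^ 2 * u)%N => v abk odd_v.
have vb : (v * b = 2 * (2 * k - 1))%N by lia.
have even_b : ~~ odd b by have := congr1 odd vb; rewrite !oddM odd_v /= => ->.
have bE : b = (2 * b./2)%N by lia.
exists b./2 => //.
have vb2 : (v * b./2 = 2 * k - 1)%N by move: vb; rewrite [in LHS]bE; lia.
have : odd (v * b./2) by rewrite vb2; lia.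
by rewrite oddM => /andP [].
Qed.

(** * The dichotomy for Diophantine tuples *)

Theorem theorem1p1 (n : int) (K : fieldExtType rat) (m : nat) (t : 'I_m -> nat)
    (hn : fundamental_discriminant n) (hK : is_Q_sqrt n K) (hm : (2 <= m)%N)
    (ht : diophantine_tuple n t) :
  norm_tuple K n t \/
  exists t' : 'I_m -> nat,
    (forall i, t i = (2 * t' i)%N) /\ norm_tuple K (n%:~R / 4 : rat) t'.
Proof.
have [t_gt0 t_inj t_sq] := ht.
have sq i j : i != j -> exists x : int, (t i * t j)%:R + n = x ^+ 2.
  rewrite -val_eqE neq_ltn => /orP [/t_sq //|/t_sq [x]].
  by rewrite mulnC => ?; exists x.
(* A second index exists because m >= 2; this is what makes each [t i] divide some x^2 - n. *)
have other (i : 'I_m) : exists j, i != j.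
  have m0 : (0 < m)%N by exact: ltnW.
  have [->|i_neq] := eqVneq i (Ordinal m0); first by exists (Ordinal hm).
  by exists (Ordinal m0).
have dvd_sq i u : (u %| t i)%N -> exists x : int, (u%:Z %| x ^+ 2 - n)%Z.
  move=> ut; have [j /sq [x E]] := other i; exists x.
  by rewrite -E addrK natz; apply: dvdn_mulr.
have [/andP [/eqP n5 /existsP [i0 odd_i0]]|not_exc] :=
    boolP (((n %% 8)%Z == 5) && [exists i, odd (logn 2 (t i))]).
  right; have half j : exists2 u, odd u & t j = (2 * u)%N.
    have even_i0 : ~~ odd (t i0).
      rewrite -dvdn2; apply: dvdn_trans (pfactor_dvdnn 2 (t i0)).
      by rewrite dvdn_exp // odd_gt0.
    have two k : i0 != k ->
        (exists2 u, odd u & t i0 = (2 * u)%N) /\ (exists2 u, odd u & t k = (2 * u)%N).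
      case/sq=> x E; apply: four_mod_eight_product odd_i0.
      exact: square_sub_five_mod_eight_product n5 E even_i0.
    (* For [i0] itself, the conclusion comes from pairing it with any other index. *)
    have [<-|/two []//] := eqVneq i0 j.
    by have [k /two []] := other i0.
  have t2 j : t j = (2 * (t j)./2)%N by have [u _ ->] := half j; rewrite !mul2n doubleK.
  exists (fun j => (t j)./2); split=> //; split; first split.
  - by move=> j; have := t_gt0 j; rewrite {1}t2; lia.
  - by move=> j k jk; apply: t_inj; rewrite (t2 j) (t2 k) jk.
  (* Dividing t_j t_k + n = x^2 by 4 gives the square of x / 2. Here [x] is odd, so the root is a
     proper half-integer. *)
  - move=> j k /t_sq [x E]; exists (x%:~R / 2).
    have E' : (t j * t k)%:R + n%:~R = x%:~R ^+ 2 :> rat.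
      by rewrite -[RHS](rmorphXn intr) -E rmorphD /= rmorph_nat.
    have -> : (x%:~R / 2) ^+ 2 = x%:~R ^+ 2 / 4 :> rat by field.
    by rewrite -E' (t2 j) (t2 k) !mul2n !doubleK -!mul2n !natrM; field.
  suff /choice : forall i, exists I : set K, integral_ideal I /\ (t i)./2 = ideal_norm I.
    by case=> I normI; exists I.
  move=> i; have [u odd_u tE] := half i.
  have [|x ux] := @dvd_sq i u; first by rewrite tE dvdn_mull.
  (* Each halved entry is the odd number [u], so g = 1 and no factor 2 is required, whatever [n] is
     modulo 8. *)
  have [I] := @ideal_of_norm K n x 1 u false hn hK (fun h => False_ind _ (notF h)) isT odd_u ux.
  by rewrite tE mul2n doubleK !mul1n; exists I.
left; split=> //.
suff /choice : forall i, exists I : set K, integral_ideal I /\ t i = ideal_norm I.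
  by case=> I normI; exists I.
move=> i; have [g [u [g0 odd_u tE]]] := square_mul_odd_decomposition (t_gt0 i).
have [|x ux] := @dvd_sq i u; first by rewrite tE !dvdn_mull.
rewrite tE; apply: ideal_of_norm ux => //.
(* A factor 2 occurs only if the valuation of [t i] is odd, and outside the exceptional case this
   excludes n = 5 modulo 8. *)
by move=> odd_i; apply: contra not_exc => ->; apply/existsP; exists i.
Qed.
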